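(* Let $q\in\mathbb{N}$ and let $T$ be a $(q+1)$-homogeneous tree. For $1\leq p<\infty$, the differentiation operator $D$ on the Hardy space $\mathbb{T}_p(T)$ has operator norm $2$.
   Context: A tree $T$ is a locally finite, connected, simply-connected graph, identified with its set of vertices, and rooted at a vertex $o$. It is $(q+1)$-homogeneous ($q\in\mathbb{N}=\{1,2,\dots\}$) if every vertex has exactly $q+1$ neighbors. For a vertex $v$, $|v|$ is the number of edges in the path from $o$ to $v$. For $v\neq o$, $v^-$ denotes the unique neighbor of $v$ lying on the path from $o$ to $v$ (the parent of $v$). The derivative of $f:T\to\mathbb{C}$ is $f'(v)=f(v)-f(v^-)$ for $v\neq o$ and $f'(o)=0$; the differentiation operator is $Df=f'$. For $1\leq p<\infty$, set $M_p(0,f)=|f(o)|$ and, for $n\in\mathbb{N}$, \[M_p(n,f)=\left(\frac{1}{(q+1)q^{n-1}}\sum_{|v|=n}|f(v)|^p\right)^{1/p}.\] The Hardy space $\mathbb{T}_p(T)$ is the set of all $f:T\to\mathbb{C}$ with $\|f\|_p=\sup_{n\in\mathbb{N}_0}M_p(n,f)<\infty$, where $\mathbb{N}_0=\mathbb{N}\cup\{0\}$; it is a Banach space under $\|\cdot\|_p$. $D$ is considered as an operator from $\mathbb{T}_p(T)$ to $\mathbb{T}_p(T)$ (it is bounded). *)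

(* Defs.v *)
From mathcomp Require Import all_boot all_order all_algebra.
From mathcomp Require Import all_classical all_reals all_analysis.
From mathcomp Require Import complex.

Set Implicit Arguments.
Unset Strict Implicit.
Unset Printing Implicit Defensive.

Import Order.TTheory GRing.Theory Num.Theory.

Local Open Scope classical_set_scope.
Local Open Scope ring_scope.

(* A graph is given by its adjacency relation [e] on the vertex set [T], which
   may be infinite. *)
Record is_tree (T : choiceType) (e : rel T) : Prop := IsTree {
  tree_sym : symmetric e;
  tree_irr : irreflexive e;
  tree_locally_finite : forall v, finite_set [set w | e v w];
  tree_connected : forall v w, exists s : seq T, path e v s /\ last v s = w;
  (* [:: v; w] with v, w adjacent is an [ucycle], hence the bound 2 *)
  tree_acyclic : forall s : seq T, ucycle e s -> (size s <= 2)%N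
}.

Definition homogeneous_tree (T : choiceType) (e : rel T) (q : nat) : Prop :=
  is_tree e /\ forall v, ([set w | e v w] #= `I_q.+1)%card.

(* The vertices after [v] on the simple path from [v] to [w], which is unique
   in a tree; the size of this sequence is the number of edges. *)
Definition tree_path (T : choiceType) (e : rel T) (v w : T) : seq T :=
  xget [::] [set s | [/\ path e v s, uniq (v :: s) & last v s = w]].

Definition level (T : choiceType) (e : rel T) (o v : T) : nat :=
  size (tree_path e o v).

(* At [v = o] there is no such neighbor and the value is the default [v]. *)
Definition parent (T : choiceType) (e : rel T) (o v : T) : T :=
  xget v [set w | e v w /\ w \in o :: tree_path e o v].

Definition tree_deriv (R : realType) (T : choiceType) (e : rel T) (o : T)
    (f : T -> R[i]) : T -> R[i] :=
  fun v => if v == o then 0 else f v - f (parent e o v).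

(* The modulus [ComplexField.Normc.normc] is real-valued, whereas [`|z|] on
   [R[i]] has its values in [R[i]]. The sum is over a finite set when the graph
   is locally finite. *)
Definition hardy_mean (R : realType) (T : choiceType) (e : rel T) (o : T)
    (q : nat) (p : R) (n : nat) (f : T -> R[i]) : R :=
  if n == 0%N then ComplexField.Normc.normc (f o)
  else (((q + 1) * q ^ (n - 1))%N%:R^-1 *
        \sum_(v \in [set v | level e o v = n])
          ComplexField.Normc.normc (f v) `^ p) `^ p^-1.

Definition hardy_norm (R : realType) (T : choiceType) (e : rel T) (o : T)
    (q : nat) (p : R) (f : T -> R[i]) : \bar R :=
  ereal_sup (range (fun n : nat => (hardy_mean e o q p n f)%:E)).

Definition hardy_space (R : realType) (T : choiceType) (e : rel T) (o : T)
    (q : nat) (p : R) : set (T -> R[i]) :=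
  [set f | (hardy_norm e o q p f < +oo)%E].

(* The supremum of the norms of the [A f], for [f] in the closed unit ball of
   [H]. As [N] is extended real-valued, a finite value for a linear [A] also
   says that [A] maps [H = {f | N f < +oo}] to itself and is bounded. *)
Definition operator_norm (R : realType) (X : Type) (N : X -> \bar R)
    (H : set X) (A : X -> X) : \bar R :=
  ereal_sup [set N (A f) | f in H `&` [set f | (N f <= 1)%E]].

(* Main.v *)
Require Import Defs.
From mathcomp Require Import all_boot all_order all_algebra finmap.
From mathcomp Require Import all_classical all_reals all_analysis.
From mathcomp Require Import complex.
From mathcomp Require Import lra zify.

(** Write [A_n g] for the average of [g] over the sphere of radius [n] about
the root, so that the [n]-th mean of [f] is [A_n (|f|^p)] to the power [1/p].

Everything rests on one fact about the tree: [A_(n+1) (g o parent) = A_n g]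
([sphere_avg_parent]). Indeed the sphere of radius [n+1] is the disjoint union
of the sets of children of the vertices of the sphere of radius [n], and these
sets all have the same size: [q+1] for the root, whose neighbors are all
children, and [q] for any other vertex, which loses its parent
([card_children]). So passing to the parent multiplies each sum by the factor
by which the size of the sphere grows.

Upper bound ([hardy_norm_deriv_le]): by convexity of the [p]-th power,
[|a - b|^p <= 2^(p-1) (|a|^p + |b|^p)] ([powRD_le]). Averaging this with
[a = f v] and [b = f (parent v)] over the sphere of radius [n+1] gives
[A_(n+1) (|f'|^p) <= 2^(p-1) (A_(n+1) (|f|^p) + A_n (|f|^p))], which is at most
[2^p] when [f] has norm at most 1.

Lower bound: [f v = (-1)^|v|] has modulus 1 everywhere, hence norm 1, whereas
consecutive levels have opposite signs, so that [f'] has modulus 2 at every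
vertex but the root ([hardy_mean_deriv_level_sign]).

The combinatorial part derives this description of spheres from connectedness
and the absence of cycles, by way of the uniqueness of simple paths
([tree_path_unique]). *)

Set Implicit Arguments.
Unset Strict Implicit.
Unset Printing Implicit Defensive.

Import Order.TTheory GRing.Theory Num.Theory.
Import ComplexField.Normc.

Local Open Scope classical_set_scope.
Local Open Scope ring_scope.

(** * Simple paths in a tree *)

Lemma sym_path_rev (T : eqType) (e : rel T) (x y : T) (s : seq T) :
  symmetric e -> path e x (rcons s y) -> path e y (rcons (rev s) x).
Proof.
move=> sym_e; rewrite -rev_cons -(belast_rcons x s y) => xsy.
by rewrite -[X in path _ X](last_rcons x s y) rev_path (eq_path (e' := e)).
Qed.

Definition sphere (T : choiceType) (e : rel T) (o : T) (n : nat) : set T :=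
  [set v | level e o v = n].

Definition children (T : choiceType) (e : rel T) (o u : T) : set T :=
  [set v | v != o /\ parent e o v = u].

Section Tree.
Variables (T : choiceType) (e : rel T).
Hypothesis tree : is_tree e.

(** Two different simple paths with the same endpoints would contain a cycle of
length at least 3. After removal of a common first edge, the paths leave [v]
along different edges; [x] is the first vertex of [s] that also lies on [t],
and the cycle follows [s] to [x] and comes back along [t]. *)
Lemma tree_path_unique (v : T) (s t : seq T) :
    path e v s -> uniq (v :: s) -> path e v t -> uniq (v :: t) ->
  last v s = last v t -> s = t.
Proof.
elim: s v t => [|a s IH] v [|b t] //=.
- by move=> _ _ _ /andP[/negP vt _] vE; case: vt; rewrite {1}vE mem_last.
- by move=> _ /andP[/negP vs _] _ _ vE; case: vs; rewrite -{1}vE mem_last.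
move=> /andP[va pa] /andP[vs us] /andP[vb pb] /andP[vt ut] st.
have [ab|ab] := eqVneq a b.
  by rewrite -ab in pb ut st *; congr (_ :: _); exact: (IH a).
have [x [s1 [s2 [sE xt s1t]]]] : exists x s1 s2,
    [/\ a :: s = s1 ++ x :: s2, x \in b :: t & ~~ has (mem (b :: t)) s1].
  have : has (mem (b :: t)) (a :: s).
    by apply/hasP; exists (last a s); rewrite ?mem_last// inE st mem_last.
  by move=> /split_find[x s1 s2 xt s1t]; exists x, s1, s2; rewrite -cat_rcons.
have [t1 [t2 tE]] : exists t1 t2, b :: t = t1 ++ x :: t2.
  by case/splitPr: xt => t1 t2; exists t1, t2.
have {}pa : path e v (s1 ++ x :: s2) by rewrite -sE /= va.
have {}pb : path e v (t1 ++ x :: t2) by rewrite -tE /= vb.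
have : ucycle e (v :: s1 ++ x :: rev t1).
  rewrite /ucycle; apply/andP; split.
    move: pb pa; rewrite /= rcons_cat /= -!cat_rcons !cat_path.
    move=> /andP[+ _] /andP[-> _].
    rewrite last_rcons/=.
    exact: sym_path_rev (tree_sym tree).
  have uab : uniq (a :: s) by [].
  have utb : uniq (b :: t) by [].
  rewrite sE tE in vs vt uab utb s1t.
  move: vs vt uab utb s1t.
  rewrite /= !cat_uniq !mem_cat /= !inE !mem_rev rev_uniq !has_rev !negb_or.
  move=> /and3P[-> -> _] /and3P[-> _ _] /and3P[-> /andP[xs1 _] _].
  move=> /and3P[-> /andP[xt1 _] _] s1t /=; rewrite xs1 xt1 !andbT/=.
  apply/hasPn => y yt; apply: contra s1t => ys.
  by apply/hasP; exists y => //=; rewrite mem_cat yt.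
(* A cycle of length 2 would force [a = x = b]. *)
move=> /(tree_acyclic tree); rewrite /= size_cat/= size_rev => sz.
case: s1 sE s1t {pa} sz => [|? ?] /=; last by lia.
case: t1 tE {pb} => [|? ?] /=; last by lia.
by move=> [xb _] [xa _]; move: ab; rewrite xa xb eqxx.
Qed.

Lemma tree_pathP (v w : T) :
  [/\ path e v (tree_path e v w), uniq (v :: tree_path e v w)
    & last v (tree_path e v w) = w].
Proof.
have [s [vs <-]] := tree_connected tree v w.
apply: (@xgetPex _ [::]
  [set t | [/\ path e v t, uniq (v :: t) & last v t = _]]).
by case/shortenP: vs => s' *; exists s'.
Qed.

Lemma tree_path_eq (v w : T) (s : seq T) :
  path e v s -> uniq (v :: s) -> last v s = w -> tree_path e v w = s.
Proof.
have [tp tu tl] := tree_pathP v w.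
by move=> sp su sl; apply: (tree_path_unique tp tu sp su); rewrite tl.
Qed.

Variable o : T.

Lemma level_root : level e o o = 0%N.
Proof. by rewrite /level (@tree_path_eq o o [::]). Qed.

Lemma level_eq0 (v : T) : (level e o v == 0%N) = (v == o).
Proof.
apply/idP/eqP => [|->]; last by rewrite level_root.
by have [_ _ vE] := tree_pathP o v; rewrite size_eq0 -{2}vE => /eqP ->.
Qed.

Lemma tree_path_rcons (u v : T) : e u v -> v \notin o :: tree_path e o u ->
  tree_path e o v = rcons (tree_path e o u) v.
Proof.
have [tp tu tl] := tree_pathP o u => uv vu.
apply: tree_path_eq; rewrite ?last_rcons// ?rcons_path ?tp ?tl//.
by rewrite -rcons_cons rcons_uniq vu.
Qed.

(** This is what makes the parent unique. The initial segment, up to [w], of the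
path from [o] to [v] becomes, with the edge from [w] to [v] added, a simple path
to [v], and so it is the whole path. *)
Lemma tree_path_last_edge (v w : T) : e v w -> w \in o :: tree_path e o v ->
  tree_path e o v = rcons (tree_path e o w) v.
Proof.
move=> vw wv; have [tp tu tl] := tree_pathP o v.
have [s1 [s2 [sE s1w]]] : exists s1 s2,
    o :: tree_path e o v = (o :: s1) ++ s2 /\ last o s1 = w.
  by case/splitPl: wv => s1 s2; exists s1, s2.
case: sE => sE; rewrite sE in tp tu tl.
move: tp tu tl; rewrite cat_path -cat_cons cat_uniq last_cat s1w.
move=> /andP[p1 p2] /and3P[u1 /hasPn d u2] s2v.
have s1E : tree_path e o w = s1 by apply: tree_path_eq.
apply: tree_path_rcons; rewrite ?s1E ?(tree_sym tree w)//.
case: s2 {sE p2 u2} d s2v => [_ /= wE|y s2 d <-].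
  by move: vw; rewrite -wE (tree_irr tree).
by apply: d; rewrite /= mem_last.
Qed.

Lemma parent_eq (v w : T) : e v w -> w \in o :: tree_path e o v ->
  parent e o v = w.
Proof.
move=> vw wv; apply: xget_unique => // u [vu uv].
have [_ _ uE] := tree_pathP o u; have [_ _ wE] := tree_pathP o w.
rewrite -uE -wE; have := tree_path_last_edge vu uv.
rewrite (tree_path_last_edge vw wv).
by move=> /rcons_inj[->].
Qed.

Lemma parentP (v : T) : v != o ->
  e v (parent e o v) /\
  tree_path e o v = rcons (tree_path e o (parent e o v)) v.
Proof.
move=> vo.
suff [vw wv] : [set w | e v w /\ w \in o :: tree_path e o v] (parent e o v).
  by split=> //; exact: tree_path_last_edge.
apply: xgetPex; have [] := tree_pathP o v.
case/lastP: (tree_path e o v) => [_ _ ov|s x].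
  by rewrite -ov /= eqxx in vo.
rewrite rcons_path last_rcons => /andP[_ sx] _ <-; exists (last o s) => /=.
by rewrite (tree_sym tree) sx -rcons_cons mem_rcons inE mem_last orbT.
Qed.

Lemma level_parent (v : T) : v != o ->
  level e o v = (level e o (parent e o v)).+1.
Proof. by move=> /parentP[_ vE]; rewrite /level {1}vE size_rcons. Qed.

(** The vertex [v] either lies on the path to [u], and is then its parent, or
extends this path to a longer simple path. *)
Lemma adj_parent_child (u v : T) : e u v ->
  (u != o /\ v = parent e o u) \/ children e o u v.
Proof.
move=> uv; have [vu|vu] := boolP (v \in o :: tree_path e o u).
  left; split; last by rewrite (parent_eq uv).
  apply/eqP => uo; move: vu; rewrite uo (@tree_path_eq o o [::])// inE.
  move=> /eqP vo.
  by move: uv; rewrite uo vo (tree_irr tree).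
right; split; first by apply: contraNneq vu => ->; rewrite mem_head.
apply: parent_eq; first by rewrite (tree_sym tree).
rewrite (tree_path_rcons uv vu) -rcons_cons mem_rcons inE.
by have [_ _ uE] := tree_pathP o u; rewrite -{2}uE mem_last orbT.
Qed.

Lemma childrenE (u : T) :
  children e o u = if u == o then [set w | e u w]
                   else [set w | e u w] `\ parent e o u.
Proof.
have child_adj v : children e o u v -> e u v.
  by move=> [/parentP[+ _] <-]; rewrite (tree_sym tree).
case: ifPn => uo; apply/seteqP; split=> v /=.
- exact: child_adj.
- by move=> /adj_parent_child[[]|//]; rewrite uo.
- move=> uv; split; first exact: child_adj.
  (* The levels of [v] and of its grandparent differ by 2. *)
  case: uv => vo vu vpu; have := level_parent vo; have := level_parent uo.
  by rewrite vu -vpu; lia.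
- by move=> [/adj_parent_child[[_ -> []]|]].
Qed.

Lemma sphere0 : sphere e o 0 = [set o].
Proof.
apply/seteqP; split=> [v /eqP|v ->]; last exact: level_root.
by rewrite level_eq0 => /eqP.
Qed.

Lemma sphereS (n : nat) :
  sphere e o n.+1 = \bigcup_(u in sphere e o n) children e o u.
Proof.
apply/seteqP; split=> v /=.
  move=> vn; have vo : v != o by rewrite -level_eq0 vn.
  exists (parent e o v) => //.
  by apply: succn_inj; rewrite -level_parent.
by move=> [u un [vo vu]]; rewrite /sphere/= level_parent// vu un.
Qed.

Lemma finite_children (u : T) : finite_set (children e o u).
Proof.
rewrite childrenE; have := tree_locally_finite tree u.
by case: ifP => // _ ?; exact: finite_setD.
Qed.

Lemma finite_sphere (n : nat) : finite_set (sphere e o n).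
Proof.
elim: n => [|n IH]; first by rewrite sphere0.
by rewrite sphereS; apply: bigcup_finite => // u _; exact: finite_children.
Qed.

(** The children of the vertices of a sphere partition the next sphere, and the
summand is constant on each part. *)
Lemma sum_sphere_parent (V : nmodType) (g : T -> V) (n : nat) :
  \sum_(v \in sphere e o n.+1) g (parent e o v) =
  \sum_(u \in sphere e o n) g u *+ #|` fset_set (children e o u)|.
Proof.
rewrite (fsbig_finite _ (fun v => g _) (finite_sphere _)).
rewrite (fsbig_finite _ _ (finite_sphere _)).
have memS m v : v \in fset_set (sphere e o m) <-> sphere e o m v.
  by rewrite (in_fset_set (finite_sphere m)) inE.
have memC u v : v \in fset_set (children e o u) <-> children e o u v.
  by rewrite (in_fset_set (finite_children u)) inE.
rewrite (_ : fset_set _ =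
    \bigcup_(u <- fset_set (sphere e o n)) fset_set (children e o u))%fset;
  last first.
  apply/fsetP => v; apply/idP/bigfcupP.
    rewrite memS sphereS => -[u un vu].
    by exists u; rewrite ?andbT ?memS ?memC.
  move=> [u]; rewrite andbT !memS !memC => un vu.
  by rewrite sphereS; exists u.
rewrite partition_disjoint_bigfcup => [|u w _ _ uw].
  apply: eq_bigr => u _.
  rewrite (eq_big_seq (fun=> g u)) ?big_const_seq ?count_predT ?iter_addr_0//.
  by move=> v /memC[_ ->].
apply/fdisjointP => v /memC[_ vu]; apply/negP => /memC[_ vw].
by move: uw; rewrite -vu -vw eqxx.
Qed.
End Tree.

(** * A convexity inequality and moduli *)

(** Convexity of the [p]-th power at the midpoint of [2 x] and [2 y]. *)
Lemma powRD_le (R : realType) (p x y : R) : 1 <= p -> 0 <= x -> 0 <= y ->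
  (x + y) `^ p <= 2 `^ (p - 1) * (x `^ p + y `^ p).
Proof.
move=> p1 x0 y0.
have h0 : 0 <= (2^-1 : R) by lra.
have h1 : (2^-1 : R) <= 1 by lra.
have midpoint a b : 0 <= a -> 0 <= b ->
    (2^-1 * a + 2^-1 * b) `^ p <= 2^-1 * a `^ p + 2^-1 * b `^ p.
  move=> a0 b0.
  (* The second weight of a convex combination has the form [1 - t]. *)
  rewrite {2 4}(_ : 2^-1 = 1 - 2^-1); last by lra.
  by apply: (convex_powR p1 (Itv01 h0 h1)); rewrite inE /= in_itv /= andbT.
have := midpoint (2 * x) (2 * y).
rewrite !mulr_ge0// !mulrA mulVf// !mul1r => /(_ isT isT)/le_trans; apply.
rewrite !powRM// !mulrA -powR_inv1// -powRD ?pnatr_eq0 ?implybT//.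
by rewrite (addrC _ p) -mulrDr.
Qed.

Lemma normc_ge0 (R : rcfType) (z : R[i]) : 0 <= normc z.
Proof. by case: z => a b; exact: sqrtr_ge0. Qed.

Lemma normc_sign (R : rcfType) (n : nat) : normc ((-1) ^+ n : R[i]) = 1.
Proof.
elim: n => [|n IH]; first by rewrite expr0 normc1.
by rewrite exprS normcM IH normcN normc1 mulr1.
Qed.

(** * Averages over spheres *)

Section SphereAverage.
Variables (R : realType) (q : nat) (T : choiceType) (e : rel T) (o : T).
Hypotheses (q_gt0 : (0 < q)%N) (homT : homogeneous_tree e q).
Let tree : is_tree e := proj1 homT.

Lemma card_children (u : T) :
  #|` fset_set (children e o u)| = (if u == o then q.+1 else q).
Proof.
have cardE : #|` fset_set [set w | e u w]| = q.+1.
  by apply: card_fset_set; exact: homT.2.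
rewrite (childrenE tree); case: ifPn => // uo.
have finE := tree_locally_finite tree u.
have := cardfsD1 (parent e o u) (fset_set [set w | e u w]).
rewrite cardE -fset_setD1// (in_fset_set finE) mem_set; last first.
  by have [] := parentP tree uo.
by move=> /eqP; rewrite eqSS => /eqP <-.
Qed.

(** The size of the sphere of radius [n]; [sphere_avg_cst] confirms it. *)
Definition sphere_card (n : nat) : nat :=
  if n is m.+1 then ((q + 1) * q ^ m)%N else 1%N.

Definition sphere_avg (n : nat) (g : T -> R) : R :=
  (sphere_card n)%:R^-1 * \sum_(v \in sphere e o n) g v.

(** The [q+1] children of the root, or the [q] children of any other vertex,
account exactly for the growth of the sphere. *)
Lemma sphere_avg_parent (n : nat) (g : T -> R) :
  sphere_avg n.+1 (g \o parent e o) = sphere_avg n g.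
Proof.
rewrite /sphere_avg (sum_sphere_parent tree).
case: n => [|n].
  rewrite (sphere0 tree) !fsbig_set1 card_children eqxx /= expn0 muln1 addn1.
  by rewrite -(mulr_natl (g o)) mulKf ?pnatr_eq0// invr1 mul1r.
under eq_fsbigr => u.
  rewrite inE => un; rewrite card_children ifN; last first.
    by rewrite -(level_eq0 tree) un.
  rewrite -(mulr_natr (g u)). over.
rewrite -mulr_fsuml [_ * q%:R]mulrC mulrA; congr (_ * _).
rewrite /= expnSr mulnA [(_ * q)%:R]natrM invfM mulfVK// pnatr_eq0.
by rewrite -lt0n.
Qed.

(** Constant functions are invariant under passing to the parent, so
[sphere_avg_parent] brings the claim down to radius 0. With [c = 1] it says that
[sphere_card] is the number of vertices of the sphere. *)
Lemma sphere_avg_cst (n : nat) (c : R) : sphere_avg n (fun=> c) = c.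
Proof.
elim: n => [|n IH]; last by rewrite -[RHS]IH -(sphere_avg_parent n).
by rewrite /sphere_avg (sphere0 tree) fsbig_set1 invr1 mul1r.
Qed.

Lemma eq_sphere_avg (n : nat) (g h : T -> R) :
  (forall v, level e o v = n -> g v = h v) -> sphere_avg n g = sphere_avg n h.
Proof.
by move=> gh; congr (_ * _); apply: eq_fsbigr => v; rewrite inE => /gh.
Qed.

Lemma le_sphere_avg (n : nat) (g h : T -> R) :
  (forall v, level e o v = n -> g v <= h v) -> sphere_avg n g <= sphere_avg n h.
Proof.
move=> gh; apply: ler_wpM2l; first by rewrite invr_ge0.
rewrite !(fsbig_finite _ _ (finite_sphere tree o n)) big_seq [leRHS]big_seq /=.
apply: ler_sum => v; rewrite (in_fset_set (finite_sphere tree o n)) inE.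
exact: gh.
Qed.

Lemma sphere_avg_ge0 (n : nat) (g : T -> R) :
  (forall v, 0 <= g v) -> 0 <= sphere_avg n g.
Proof. by move=> g0; rewrite mulr_ge0 ?invr_ge0// fsumr_ge0. Qed.

Lemma sphere_avgD (n : nat) (g h : T -> R) :
  sphere_avg n (fun v => g v + h v) = sphere_avg n g + sphere_avg n h.
Proof.
by rewrite /sphere_avg fsbig_split /= ?mulrDr//; exact: (finite_sphere tree).
Qed.

Lemma sphere_avgZ (n : nat) (c : R) (g : T -> R) :
  sphere_avg n (fun v => c * g v) = c * sphere_avg n g.
Proof. by rewrite /sphere_avg -mulr_fsumr mulrCA. Qed.

(** * Hardy means and the operator norm *)

Variable p : R.
Hypothesis p1 : 1 <= p.
Let p_gt0 : 0 < p. Proof. exact: lt_le_trans p1. Qed.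
Let p_neq0 : p != 0. Proof. by rewrite gt_eqF. Qed.

(** At [n = 0] the sphere is reduced to the root and the [p]-th power and root
cancel, so the separate clause of the definition fits the general formula. *)
Lemma hardy_meanE (n : nat) (f : T -> R[i]) :
  hardy_mean e o q p n f = sphere_avg n (fun v => normc (f v) `^ p) `^ p^-1.
Proof.
case: n => [|n]; last by rewrite /hardy_mean /= subn1.
rewrite /hardy_mean /sphere_avg eqxx (sphere0 tree) fsbig_set1 invr1 mul1r.
by rewrite -powRrM mulfV ?powRr1 ?normc_ge0.
Qed.

Lemma hardy_mean_le (n : nat) (f : T -> R[i]) (c : R) : 0 <= c ->
  (hardy_mean e o q p n f <= c) =
  (sphere_avg n (fun v => normc (f v) `^ p) <= c `^ p).
Proof.
move=> c0.
have A0 : 0 <= sphere_avg n (fun v => normc (f v) `^ p).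
  by apply: sphere_avg_ge0 => v; exact: powR_ge0.
have powRK (x r : R) : 0 <= x -> r != 0 -> (x `^ r^-1) `^ r = x.
  by move=> x0 r0; rewrite -powRrM mulVf ?powRr1.
rewrite hardy_meanE; apply/idP/idP => h.
  rewrite -[leLHS](powRK _ p) ?gt_eqF//.
  by apply: ge0_ler_powR; rewrite ?nnegrE ?powR_ge0// ltW.
rewrite -[leRHS](powRK _ p^-1) ?invrK ?invr_eq0 ?gt_eqF//.
by apply: ge0_ler_powR; rewrite ?nnegrE ?powR_ge0// ?invr_ge0 ltW.
Qed.

Lemma hardy_norm_le (f : T -> R[i]) (c : R) :
  (hardy_norm e o q p f <= c%:E)%E <-> forall n, hardy_mean e o q p n f <= c.
Proof.
split=> [fc n|fc].
  rewrite -lee_fin; apply: le_trans fc; apply: ereal_sup_ubound.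
  by exists n.
by apply: ge_ereal_sup => _ [n _ <-]; rewrite lee_fin.
Qed.

(** The convexity inequality takes the place of Minkowski's: with both means at
most 1, it already gives the sharp constant [2^(p-1) (1 + 1) = 2^p]. *)
Lemma hardy_norm_deriv_le (f : T -> R[i]) :
  (hardy_norm e o q p f <= 1)%E ->
  (hardy_norm e o q p (tree_deriv e o f) <= 2%:E)%E.
Proof.
move=> /hardy_norm_le f1; apply/hardy_norm_le => n.
have avg1 m : sphere_avg m (fun v => normc (f v) `^ p) <= 1.
  by have := f1 m; rewrite hardy_mean_le// powR1.
rewrite hardy_mean_le//; case: n => [|n].
  rewrite /sphere_avg (sphere0 tree) fsbig_set1 /tree_deriv eqxx normc0.
  by rewrite powR0 ?mulr0 ?powR_ge0.
apply: (@le_trans _ _ (sphere_avg n.+1 (fun v => 2 `^ (p - 1) *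
    (normc (f v) `^ p + normc (f (parent e o v)) `^ p)))).
  apply: le_sphere_avg => v vn.
  have vo : v != o by rewrite -(level_eq0 tree) vn.
  rewrite /tree_deriv ifN//.
  apply: le_trans (powRD_le p1 (normc_ge0 _) (normc_ge0 _)).
  apply: ge0_ler_powR; rewrite ?nnegrE ?(ltW p_gt0) ?addr_ge0 ?normc_ge0//.
  by rewrite (le_trans (le_normcD _ _))// normcN.
rewrite sphere_avgZ sphere_avgD.
have -> := sphere_avg_parent n (fun v => normc (f v) `^ p).
rewrite -(@mulr_powRB1 _ 2 p)//.
rewrite mulrC ler_wpM2r ?powR_ge0//.
by have := avg1 n; have := avg1 n.+1; lra.
Qed.

Definition level_sign (v : T) : R[i] := (-1) ^+ level e o v.

Lemma hardy_mean_level_sign (n : nat) : hardy_mean e o q p n level_sign = 1.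
Proof.
rewrite hardy_meanE.
under [X in sphere_avg _ X]eq_fun do rewrite normc_sign powR1.
by rewrite sphere_avg_cst powR1.
Qed.

(** A vertex and its parent carry opposite signs. *)
Lemma hardy_mean_deriv_level_sign (n : nat) :
  hardy_mean e o q p n.+1 (tree_deriv e o level_sign) = 2.
Proof.
rewrite hardy_meanE.
rewrite (@eq_sphere_avg _ _ (fun=> 2 `^ p)) => [|v vn].
  by rewrite sphere_avg_cst -powRrM mulfV ?powRr1.
have vo : v != o by rewrite -(level_eq0 tree) vn.
rewrite /tree_deriv ifN// /level_sign (level_parent tree vo) exprS mulN1r.
by rewrite -opprD normcN -mulr2n normcMn normc_sign.
Qed.
End SphereAverage.

Theorem theorem5p2 (R : realType) (q : nat) (T : choiceType) (e : rel T)
    (o : T) (p : R) (hq : (0 < q)%N) (hT : homogeneous_tree e q) (hp : 1 <= p) :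
  operator_norm (hardy_norm e o q p) (hardy_space e o q p)
    (@tree_deriv R T e o) = 2%:E.
Proof.
apply/eqP; rewrite eq_le; apply/andP; split.
  by apply: ge_ereal_sup => _ [f [_ f1] <-]; exact: hardy_norm_deriv_le.
have s1 : (hardy_norm e o q p (level_sign R e o) <= 1)%E.
  by apply/hardy_norm_le => n; rewrite hardy_mean_level_sign.
apply: (@le_trans _ _
    (hardy_norm e o q p (tree_deriv e o (level_sign R e o)))).
  apply: ereal_sup_ubound; exists 1%N => //.
  by rewrite hardy_mean_deriv_level_sign.
apply: ereal_sup_ubound; exists (level_sign R e o) => //; split=> //.
by rewrite /hardy_space /= (le_lt_trans s1)// ltry.
Qed.
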